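(* Let $\mathcal H$ be a complex separable Hilbert space, let $\mathbb{D}=\{z\in\mathbb{C}:|z|<1\}$, and let $F:\mathbb{D}\to\mathcal B(\mathcal H)$ be a function (no regularity assumed) such that (1) for every $z\in\mathbb{D}$, the real part $\operatorname{Re}F(z)=\tfrac12\big(F(z)+F(z)^*\big)$ is a positive contraction, i.e. $0\le \operatorname{Re}F(z)\le I$; (2) the function $z\mapsto F(z)+zF(z)^*$ is holomorphic on $\mathbb{D}$. Then $F$ is constant.
   Context: $\mathcal B(\mathcal H)$ denotes the algebra of bounded linear operators on $\mathcal H$, and $T^*$ is the adjoint of $T$. For self-adjoint operators, $S\le T$ means $T-S$ is positive semidefinite. *)

(* Defs.v *)
From HB Require Import structures.
From mathcomp Require Import all_boot all_order all_algebra.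
From mathcomp Require Import reals complex.
Set Implicit Arguments. Unset Strict Implicit. Unset Printing Implicit Defensive.
Import Order.TTheory GRing.Theory Num.Theory.
Local Open Scope ring_scope.

Section HilbertDefs.
Variable R : realType.
Local Notation C := R[i].
Variable H : lmodType C.
Variable ip : H -> H -> C.

Definition inner_product_axioms : Prop :=
  [/\ forall (a : C) (x y z : H), ip (a *: x + y) z = a * ip x z + ip y z,
      forall x y : H, ip y x = (ip x y)^*,
      forall x : H, 0 <= ip x x
    & forall x : H, ip x x = 0 -> x = 0].

(* induced norm ||x|| = sqrt <x,x> (a nonnegative real, viewed in C) *)
Definition hnorm (x : H) : C := sqrtC (ip x x).

Definition hcauchy (u : nat -> H) : Prop :=
  forall eps : C, 0 < eps -> exists N : nat,
    forall m n : nat, (N <= m)%N -> (N <= n)%N -> hnorm (u m - u n) < eps.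

Definition hconverges (u : nat -> H) (l : H) : Prop :=
  forall eps : C, 0 < eps -> exists N : nat,
    forall n : nat, (N <= n)%N -> hnorm (u n - l) < eps.

Definition hcomplete : Prop :=
  forall u : nat -> H, hcauchy u -> exists l : H, hconverges u l.

Definition hseparable : Prop :=
  exists s : nat -> H, forall (x : H) (eps : C), 0 < eps ->
    exists n : nat, hnorm (x - s n) < eps.

Definition separable_complex_hilbert : Prop :=
  [/\ inner_product_axioms, hcomplete & hseparable].

Definition bounded_op (T : H -> H) : Prop :=
  linear T /\ exists M : C, forall x : H, hnorm (T x) <= M * hnorm x.

Definition is_adjoint (T S : H -> H) : Prop :=
  forall x y : H, ip (T x) y = ip x (S y).

Definition op_le (A B : H -> H) : Prop :=
  forall x : H, 0 <= ip (B x - A x) x.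

Definition opRe (T Ts : H -> H) : H -> H := fun x => 2^-1 *: (T x + Ts x).

Definition open_unit_disk (z : C) : Prop := `|z| < 1.

(* G : D -> B(H) is holomorphic on D: at every z in D it is complex
   differentiable in operator norm, with a bounded derivative L:
   || (G w - G z)/(w - z) - L ||_op -> 0 as w -> z (w in D). *)
Definition holomorphic_on_disk (G : C -> H -> H) : Prop :=
  forall z : C, open_unit_disk z ->
    exists L : H -> H, bounded_op L /\
      forall eps : C, 0 < eps -> exists delta : C, 0 < delta /\
        forall w : C, open_unit_disk w -> 0 < `|w - z| < delta ->
          forall x : H,
            hnorm ((w - z)^-1 *: (G w x - G z x) - L x) <= eps * hnorm x.

End HilbertDefs.

(* Main.v *)
Require Import Defs.
From HB Require Import structures.
From mathcomp Require Import all_boot all_order all_algebra.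
From mathcomp Require Import all_classical all_reals all_analysis.
From mathcomp Require Import ring lra.
From mathcomp Require Import reals complex.
Set Implicit Arguments. Unset Strict Implicit. Unset Printing Implicit Defensive.
Import Order.TTheory GRing.Theory Num.Theory.
Import numFieldNormedType.Exports.
Local Open Scope classical_set_scope.
Local Open Scope ring_scope.

(** For a unit vector [x] put [f z = <F z x, x>] and [u = Re f], so that
    [0 <= u <= 1] and [g z = f z + z * conj (f z)] is holomorphic.  Dividing by
    [1 - z] and passing to the right half-plane by [w = (1 + z) / (1 - z)], [g]
    becomes a holomorphic [h] with [Re (h w) = u * Re w].  The Schwarz-Pick
    inequality for the half-plane, applied to [h] and to [w - h], gives
    [|h'| <= u] and [|1 - h'| <= 1 - u]; hence [h' = u] is real.  By the
    Cauchy-Riemann equations [u] is then constant, so [h] is affine and [f] is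
    constant.  Polarization yields the claim for [F].

    Schwarz-Pick is derived from a minimum principle.  For [q] holomorphic on
    the punctured disk, Goursat's theorem for [q (exp w)] on a rectangle of
    height [2 pi] shows that the means of [Re q] over two concentric circles
    agree; it only uses primitives along the sides of the rectangle, and the
    mean value theorem turns it into equality of [Re q] at one pair of points
    of the two circles. *)

Local Notation Re := complex.Re.
Local Notation Im := complex.Im.

(** * Real calculus: derivatives by explicit error bounds, nested intervals, mean values *)

Lemma is_derive1_approx (R : realType) (f : R -> R) (x d : R) :
  (forall e, 0 < e -> exists2 dl : R, 0 < dl &
     forall h, `|h| < dl -> `|f (x + h) - f x - d * h| <= e * `|h|) ->
  is_derive x (1 : R) f d.
Proof.
move=> H.
have cv : h^-1 *: ((f \o shift x) (h *: (1 : R)) - f x) @[h --> 0^'] --> d.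
  apply/cvgrPdist_le => /= e e0; have [dl dl0 Hd] := H e e0.
  near=> h.
  have h0 : h != 0 by near: h; exact: nbhs_dnbhs_neq.
  have hd : `|h| < dl.
    by near: h; exact: dnbhs0_lt.
  have -> : d - h^-1 *: (f (h *: 1 + x) - f x) = - h^-1 * (f (x + h) - f x - d * h).
    rewrite /GRing.scale /= mulr1 (addrC h).
    by field.
  rewrite normrM normrN normfV mulrC ler_pdivrMr ?normr_gt0 //.
  exact: Hd.
apply: DeriveDef; first by apply/cvg_ex; exists d.
exact: cvg_lim.
Unshelve. all: by end_near.
Qed.

Lemma approx_is_derive1 (R : realType) (f : R -> R) (x d : R) :
  is_derive x (1 : R) f d ->
  forall e, 0 < e -> exists2 dl : R, 0 < dl &
     forall h, `|h| < dl -> `|f (x + h) - f x - d * h| <= e * `|h|.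
Proof.
move=> [cv dE] e e0.
have : h^-1 *: ((f \o shift x) (h *: (1 : R)) - f x) @[h --> 0^'] --> d.
  by rewrite -dE; exact: cv.
move=> /cvgrPdist_le /(_ e e0); rewrite near_withinE => /nbhs_ballP[dl /= dl0 Hd].
exists dl => // h hd.
have [->|h0] := eqVneq h 0; first by rewrite addr0 mulr0 subr0 subrr normr0 mulr0.
have := Hd h; rewrite /ball /= sub0r normrN => /(_ hd h0).
rewrite /GRing.scale /= mulr1 (addrC h).
rewrite (_ : d - _ = - h^-1 * (f (x + h) - f x - d * h)); last by field.
by rewrite normrM normrN normfV mulrC ler_pdivrMr ?normr_gt0.
Qed.

(** The point is the supremum of the left ends. Comparing a left end and a right end at the larger
    of their two indices shows that every right end bounds all left ends. *)
Lemma nested_intervals (R : realType) (u : nat -> R) (l : R) :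
  (forall n, u n <= u n.+1) ->
  (forall n, u n.+1 + l / 2 ^+ n.+1 <= u n + l / 2 ^+ n) -> 0 <= l ->
  exists x, forall n, u n <= x <= u n + l / 2 ^+ n.
Proof.
move=> u1 u2 l0.
have ui : {homo u : m n / (m <= n)%N >-> m <= n}.
  by apply: homo_leq => //; exact: le_trans.
have vi : {homo (fun n => - (u n + l / 2 ^+ n)) : m n / (m <= n)%N >-> m <= n}.
  by apply: homo_leq => [//|???|n]; [exact: le_trans|rewrite lerN2].
have uv m n : u m <= u n + l / 2 ^+ n.
  apply: (@le_trans _ _ (u (maxn m n))); first by apply: ui; exact: leq_maxl.
  apply: (@le_trans _ _ (u (maxn m n) + l / 2 ^+ (maxn m n))).
    by rewrite lerDl divr_ge0 // exprn_ge0.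
  have /= := vi n (maxn m n) (leq_maxr _ _); by rewrite lerN2.
exists (sup (range u)) => n; apply/andP; split.
  apply: ub_le_sup; last by exists n.
  by exists (u 0%N + l / 2 ^+ 0) => _ [m _ <-].
by apply: ge_sup; [exists (u 0%N), 0%N|move=> _ [m _ <-]].
Qed.

Lemma MVT_cc (R : realType) (f df : R -> R) (a b : R) : a < b ->
  (forall t, a <= t <= b -> is_derive t (1 : R) f (df t)) ->
  exists2 c, a < c < b & f b - f a = df c * (b - a).
Proof.
move=> ab fE.
have [||c] := @MVT R f df a b ab; last by rewrite in_itv /=; exists c.
  by move=> t; rewrite in_itv /= => /andP[ta tb]; apply: fE; rewrite !ltW.
by apply: derivable_within_continuous => t; rewrite in_itv /= => /fE[].
Qed.

(** * Goursat's theorem for closed forms on rectangles *)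

(* Line integral of [A dt + B ds] around a rectangle, expressed through the
   increments of primitives [PA] of [A] in [t] and [PB] of [B] in [s]. *)
Definition circulation (R : realType) (PA PB : R -> R -> R) (x x' y y' : R) : R :=
  (PA x' y' - PA x' y) - (PA x y' - PA x y)
  - ((PB x' y' - PB x y') - (PB x' y - PB x y)).

(** Circulation is additive when the rectangle is cut into four equal parts, so by the triangle
    inequality one part carries at least a quarter of it; [p] is the lower left corner of that
    part. *)
Lemma circulation_quarter (R : realType) (PA PB : R -> R -> R) (x y S T g : R) :
  0 <= S -> 0 <= T ->
  4 * g <= `|circulation PA PB x (x + (S + S)) y (y + (T + T))| ->
  exists p : R * R, [/\ x <= p.1 <= x + S, y <= p.2 <= y + T
    & g <= `|circulation PA PB p.1 (p.1 + S) p.2 (p.2 + T)| ].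
Proof.
move=> S0 T0.
have -> : circulation PA PB x (x + (S + S)) y (y + (T + T)) =
    circulation PA PB x (x + S) y (y + T)
    + circulation PA PB (x + S) (x + S + S) y (y + T)
    + (circulation PA PB x (x + S) (y + T) (y + T + T)
       + circulation PA PB (x + S) (x + S + S) (y + T) (y + T + T)).
  by rewrite /circulation !addrA; ring.
move=> Hg.
have xx : x <= x <= x + S by rewrite lexx lerDl.
have xS : x <= x + S <= x + S by rewrite lexx lerDl S0.
have yy : y <= y <= y + T by rewrite lexx lerDl.
have yT : y <= y + T <= y + T by rewrite lexx lerDl T0.
case: (lerP g `|circulation PA PB x (x + S) y (y + T)|) => [|h1]; first by exists (x, y).
case: (lerP g `|circulation PA PB (x + S) (x + S + S) y (y + T)|) => [|h2].
  by exists (x + S, y).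
case: (lerP g `|circulation PA PB x (x + S) (y + T) (y + T + T)|) => [|h3].
  by exists (x, y + T).
case: (lerP g `|circulation PA PB (x + S) (x + S + S) (y + T) (y + T + T)|) => [|h4].
  by exists (x + S, y + T).
exfalso; move: Hg; apply/negP; rewrite -ltNge.
apply: le_lt_trans (ler_normD _ _) _.
have := ler_normD (circulation PA PB x (x + S) y (y + T))
  (circulation PA PB (x + S) (x + S + S) y (y + T)).
have := ler_normD (circulation PA PB x (x + S) (y + T) (y + T + T))
  (circulation PA PB (x + S) (x + S + S) (y + T) (y + T + T)).
move: h1 h2 h3 h4; clear; lra.
Qed.

(** The affine approximations of [A] and [B] form a closed form, because the [s]-slope of [A] and
    the [t]-slope of [B] are the same [a]. Its circulation vanishes, and only the error [d]
    counts. *)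
Lemma circulation_approx (R : realType) (A B PA PB : R -> R -> R)
    (s1 s2 t1 t2 s0 t0 a b c A0 B0 d : R) :
  s1 < s2 -> t1 < t2 ->
  (forall s t, s1 <= s <= s2 -> t1 <= t <= t2 ->
     is_derive t (1 : R) (PA s) (A s t)) ->
  (forall s t, s1 <= s <= s2 -> t1 <= t <= t2 ->
     is_derive s (1 : R) (PB ^~ t) (B s t)) ->
  (forall s t, s1 <= s <= s2 -> t1 <= t <= t2 ->
     `|A s t - A0 - (a * (s - s0) + b * (t - t0))| <= d /\
     `|B s t - B0 - (c * (s - s0) + a * (t - t0))| <= d) ->
  `|circulation PA PB s1 s2 t1 t2| <= 2 * d * ((s2 - s1) + (t2 - t1)).
Proof.
move=> s12 t12 dPA dPB Hd.
have s1I : s1 <= s1 <= s2 by rewrite lexx ltW.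
have s2I : s1 <= s2 <= s2 by rewrite lexx ltW.
have t1I : t1 <= t1 <= t2 by rewrite lexx ltW.
have t2I : t1 <= t2 <= t2 by rewrite lexx ltW.
(* Applied to the difference of opposite sides, the mean value theorem gives two values of [A] at
   the same height [x], so that [A0] and the [b] term cancel between them. *)
have [t tI|x xI Ex] := MVT_cc t12 (f := fun t => PA s2 t - PA s1 t)
    (df := fun t => A s2 t - A s1 t).
  by apply: is_deriveB; apply: dPA.
have [s sI|y yI Ey] := MVT_cc s12 (f := fun s => PB s t2 - PB s t1)
    (df := fun s => B s t2 - B s t1).
  by apply: is_deriveB; apply: dPB.
have {xI} xI : t1 <= x <= t2 by case/andP: xI => *; rewrite !ltW.
have {yI} yI : s1 <= y <= s2 by case/andP: yI => *; rewrite !ltW.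
(* The two inserted corrections both equal [a * (s2 - s1) * (t2 - t1)] and cancel. *)
have -> : circulation PA PB s1 s2 t1 t2 =
  (A s2 x - A s1 x - a * (s2 - s1)) * (t2 - t1)
  - (B y t2 - B y t1 - a * (t2 - t1)) * (s2 - s1).
  rewrite (_ : circulation _ _ _ _ _ _ =
    (PA s2 t2 - PA s1 t2) - (PA s2 t1 - PA s1 t1)
    - ((PB s2 t2 - PB s2 t1) - (PB s1 t2 - PB s1 t1)));
    last by rewrite /circulation; ring.
  by rewrite Ex Ey; ring.
have [k1 _] := Hd _ _ s2I xI; have [k2 _] := Hd _ _ s1I xI.
have [_ k3] := Hd _ _ yI t2I; have [_ k4] := Hd _ _ yI t1I.
have l1 : `|A s2 x - A s1 x - a * (s2 - s1)| <= 2 * d.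
  by move: k1 k2; clear; rewrite !ler_norml; lra.
have l2 : `|B y t2 - B y t1 - a * (t2 - t1)| <= 2 * d.
  by move: k3 k4; clear; rewrite !ler_norml; lra.
apply: le_trans (ler_normB _ _) _.
rewrite !normrM (gtr0_norm (_ : 0 < t2 - t1)) ?subr_gt0 //.
rewrite (gtr0_norm (_ : 0 < s2 - s1)) ?subr_gt0 // [leRHS]mulrDr [leRHS]addrC.
by apply: lerD; rewrite ler_pM2r // subr_gt0.
Qed.

(** Repeated quartering: if the circulation is nonzero with modulus [g], the [n]-th rectangle keeps
    at least [g / 4 ^+ n] of it. Near the common point of all rectangles, differentiability with the
    shared slope [a] bounds it by an arbitrarily small multiple of the squared side lengths, which
    also shrink like [4 ^- n]. *)
Lemma goursat (R : realType) (A B PA PB : R -> R -> R) (s1 s2 t1 t2 : R) :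
  s1 < s2 -> t1 < t2 ->
  (forall s t, s1 <= s <= s2 -> t1 <= t <= t2 ->
     is_derive t (1 : R) (PA s) (A s t)) ->
  (forall s t, s1 <= s <= s2 -> t1 <= t <= t2 ->
     is_derive s (1 : R) (PB ^~ t) (B s t)) ->
  (forall s t, s1 <= s <= s2 -> t1 <= t <= t2 -> exists a b c,
     forall e, 0 < e -> exists2 dl : R, 0 < dl &
     forall x y, `|x - s| + `|y - t| < dl ->
       `|A x y - A s t - (a * (x - s) + b * (y - t))| <= e * (`|x - s| + `|y - t|) /\
       `|B x y - B s t - (c * (x - s) + a * (y - t))| <= e * (`|x - s| + `|y - t|)) ->
  (PA s2 t2 - PA s2 t1) - (PA s1 t2 - PA s1 t1) =
  (PB s2 t2 - PB s1 t2) - (PB s2 t1 - PB s1 t1).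
Proof.
move=> s12 t12 dPA dPB closed.
suff : circulation PA PB s1 s2 t1 t2 = 0.
  by move/eqP; rewrite subr_eq0 => /eqP.
apply/eqP; case: (eqVneq (circulation PA PB s1 s2 t1 t2) 0) => // G0; exfalso.
pose S := s2 - s1; pose T := t2 - t1.
have S0 : 0 < S by rewrite /S; lra.
have T0 : 0 < T by rewrite /T; lra.
pose g := `|circulation PA PB s1 s2 t1 t2|.
have g0 : 0 < g by rewrite normr_gt0.
pose P n (p : R * R) :=
  [/\ s1 <= p.1, p.1 + S / 2 ^+ n <= s2, t1 <= p.2, p.2 + T / 2 ^+ n <= t2 &
   g / 4 ^+ n <= `|circulation PA PB p.1 (p.1 + S / 2 ^+ n) p.2 (p.2 + T / 2 ^+ n)| ].
have half n (l : R) : l / 2 ^+ n = l / 2 ^+ n.+1 + l / 2 ^+ n.+1.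
  by rewrite exprS; field; rewrite expf_neq0.
have step n (p : R * R) : exists p' : R * R, P n p ->
  [/\ P n.+1 p', p.1 <= p'.1 <= p.1 + S / 2 ^+ n.+1
   & p.2 <= p'.2 <= p.2 + T / 2 ^+ n.+1].
  (* When [P n p] fails, [p] itself is a dummy witness, so that [choice] yields a total successor
     map. *)
  case: (pselect (P n p)) => [|nP]; last by exists p.
  case: p => x y [/= sx xs ty yt].
  have := half n S; have := half n T.
  have : 0 < S / 2 ^+ n.+1 by rewrite divr_gt0 ?exprn_gt0.
  have : 0 < T / 2 ^+ n.+1 by rewrite divr_gt0 ?exprn_gt0.
  have : g / 4 ^+ n = 4 * (g / 4 ^+ n.+1).
    by rewrite exprS; field; rewrite expf_neq0.
  rewrite /P /=; move: xs yt; move: (S / 2 ^+ n) (S / 2 ^+ n.+1)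
    (T / 2 ^+ n) (T / 2 ^+ n.+1) (g / 4 ^+ n) (g / 4 ^+ n.+1).
  move=> S'' S' T'' T' g'' g' xs yt -> T'0 S'0 hT hS; move: xs yt; rewrite hT hS => xs yt.
  move=> Hc; have [||[x' y'] /= [xI yI Hg]] := circulation_quarter _ _ Hc;
    [exact: ltW|exact: ltW|].
  exists (x', y') => _; split; [split|exact: xI|exact: yI]; last exact: Hg.
  - by move: xI sx => /= /andP[+ _]; move=> /[swap]; exact: le_trans.
  - by move: xI xs; clear; rewrite /=; lra.
  - by move: yI ty => /= /andP[+ _]; move=> /[swap]; exact: le_trans.
  - by move: yI yt; clear; rewrite /=; lra.
have {step}[nxt Hnxt] := choice (fun np : nat * (R * R) => step np.1 np.2).
pose fix p n := if n is m.+1 then nxt (m, p m) else (s1, t1).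
have Pp n : P n (p n).
  elim: n => [|n IH]; last by have [] := Hnxt (n, p n) IH.
  rewrite /P /= !expr0 !divr1 /S /T (addrC s1) (addrC t1) !subrK; split => //.
have Hp n := Hnxt (n, p n) (Pp n).
have [xs Hxs] : exists x, forall n, (p n).1 <= x <= (p n).1 + S / 2 ^+ n.
  apply: nested_intervals => [n|n|]; last exact: ltW.
    by have [_ /= /andP[]] := Hp n.
  by have [_ /= /andP[_ ?] _] := Hp n; rewrite [in leRHS]half addrA lerD2r.
have [ys Hys] : exists y, forall n, (p n).2 <= y <= (p n).2 + T / 2 ^+ n.
  apply: nested_intervals => [n|n|]; last exact: ltW.
    by have [_ _ /= /andP[]] := Hp n.
  by have [_ _ /= /andP[_ ?]] := Hp n; rewrite [in leRHS]half addrA lerD2r.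
have xsI : s1 <= xs <= s2.
  have := Hxs 0%N; rewrite /= expr0 divr1 /S; lra.
have ysI : t1 <= ys <= t2.
  have := Hys 0%N; rewrite /= expr0 divr1 /T; lra.
have [a [b [c Hab]]] := closed _ _ xsI ysI.
have ST0 : 0 < S + T by lra.
(* With this error the upper bound [2 * e * (S' + T') ^+ 2] on the [n]-th rectangle is exactly half
   of the lower bound [g / 4 ^+ n]. *)
have e0 : 0 < g / (4 * (S + T) ^+ 2).
  by rewrite divr_gt0 // mulr_gt0 // exprn_gt0.
have [dl dl0 Hd] := Hab _ e0.
have [n Hn] : exists n, (S + T) / 2 ^+ n < dl.
  have : (fun n => geometric (S + T) (2^-1) n) @ \oo --> (0 : R).
    apply: cvg_geometric; rewrite ger0_norm ?invr_ge0 //; lra.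
  move=> /cvgrPdist_lt /(_ _ dl0) [n _ /(_ n (leqnn _)) /=].
  rewrite sub0r normrN ger0_norm; first by rewrite exprVn => ?; exists n.
  by rewrite mulr_ge0 ?exprn_ge0 ?invr_ge0 // ltW.
have [q1 q2 q3 q4 q5] := Pp n.
move: (Hxs n) (Hys n) => Hx Hy; move: q1 q2 q3 q4 q5 Hx Hy.
set x := (p n).1; set y := (p n).2.
set S' := S / 2 ^+ n; set T' := T / 2 ^+ n => q1 q2 q3 q4 q5 Hx Hy.
set e := g / _ in e0 Hd.
have S'0 : 0 < S' by rewrite divr_gt0 ?exprn_gt0.
have T'0 : 0 < T' by rewrite divr_gt0 ?exprn_gt0.
have Hn' : S' + T' < dl by rewrite /S' /T' -mulrDl.
have near' x' y' : x <= x' <= x + S' -> y <= y' <= y + T' ->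
   `|x' - xs| + `|y' - ys| <= S' + T'.
  by move=> Hx' Hy'; apply: lerD; move: Hx Hy Hx' Hy'; clear; rewrite ler_norml; lra.
have Hd' x' y' : x <= x' <= x + S' -> y <= y' <= y + T' ->
  `|A x' y' - A xs ys - (a * (x' - xs) + b * (y' - ys))| <= e * (S' + T') /\
  `|B x' y' - B xs ys - (c * (x' - xs) + a * (y' - ys))| <= e * (S' + T').
  move=> Hx' Hy'.
  have [|h1 h2] := Hd x' y'; first by apply: le_lt_trans Hn'; exact: near'.
  split; [apply: le_trans h1 _|apply: le_trans h2 _]; rewrite ler_pM2l //; exact: near'.
have : `|circulation PA PB x (x + S') y (y + T')| <= 2 * (e * (S' + T')) * (S' + T').
  have -> : S' + T' = (x + S' - x) + (y + T' - y) by ring.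
  apply: (@circulation_approx _ A B _ _ _ _ _ _ xs ys a b c (A xs ys) (B xs ys)).
  - by rewrite ltrDl.
  - by rewrite ltrDl.
  - by move=> s t sI tI; apply: dPA; lra.
  - by move=> s t sI tI; apply: dPB; lra.
  - have -> : (x + S' - x) + (y + T' - y) = S' + T' by ring.
    exact: Hd'.
apply/negP; rewrite -ltNge; apply: lt_le_trans q5.
have -> : 2 * (e * (S' + T')) * (S' + T') = g / 4 ^+ n / 2.
  rewrite /e /S' /T' -mulrDl.
  have -> : (4 : R) ^+ n = (2 ^+ n) ^+ 2.
    by rewrite -exprM mulnC exprM; congr (_ ^+ _); ring.
  by field; rewrite expf_neq0 //= gt_eqF.
by rewrite ltr_pdivrMr // ltr_pMr ?divr_gt0 ?exprn_gt0 // ltr1n.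
Qed.

(* Caratheodory's criterion: [phi] is the difference quotient of [f] at [z],
   completed by [d] at [0]. *)
Definition has_derivative (K : numFieldType) (f : K -> K) (z d : K) : Prop :=
  exists2 phi : K -> K, phi h @[h --> (0 : K)] --> d
    & \forall h \near (0 : K), f (z + h) - f z = phi h * h.

(** * Rules of differentiation over a numeric field *)

Section HasDerivative.
Variable K : numFieldType.
Implicit Types (f g : K -> K) (z d e c : K).

Let near0_lt (r : K) : 0 < r -> \forall h \near (0 : K), `|h| < r.
Proof. exact: nbhs0_lt. Qed.

Let cvg_cst0 c : c @[h --> (0 : K)] --> c.
Proof. by refine (@cvg_cst K c K (nbhs (0 : K)) _). Qed.

Let cvg_id0 : h @[h --> (0 : K)] --> (0 : K).
Proof. by move=> A. Qed.

Let cvgD0 f g c d : f h @[h --> (0 : K)] --> c -> g h @[h --> (0 : K)] --> d ->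
  f h + g h @[h --> (0 : K)] --> c + d.
Proof. by refine (@cvgD K K^o K (nbhs (0 : K)) _ f g c d). Qed.

Let cvgM0 f g c d : f h @[h --> (0 : K)] --> c -> g h @[h --> (0 : K)] --> d ->
  f h * g h @[h --> (0 : K)] --> c * d.
Proof. by refine (@cvgM K K (nbhs (0 : K)) _ f g c d). Qed.

Let cvgV0 f c : c != 0 -> f h @[h --> (0 : K)] --> c ->
  (f h)^-1 @[h --> (0 : K)] --> c^-1.
Proof. by move=> c0; refine (@cvgV K K (nbhs (0 : K)) _ f c c0). Qed.

Let cvgN0 f c : f h @[h --> (0 : K)] --> c -> - f h @[h --> (0 : K)] --> - c.
Proof. by refine (@cvgN K K^o K (nbhs (0 : K)) _ f c). Qed.

(** The quotient form makes the product and chain rules algebraic; the form with error bounds is the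
    one used in estimates. *)
Lemma has_derivativeP f z d : has_derivative f z d <->
  forall e, 0 < e -> exists2 dl : K, 0 < dl &
    forall h, `|h| < dl -> `|f (z + h) - f z - d * h| <= e * `|h|.
Proof.
split=> [[phi phid fE] e e0|H].
  move/cvgrPdist_le: phid => /(_ e e0) /(filterI fE) /nbhs_ballP[dl /= dl0 Hdl].
  exists dl => // h hd; have [|-> ?] := Hdl h; first by rewrite /ball /= sub0r normrN.
  by rewrite -mulrBl normrM ler_wpM2r // distrC.
exists (fun h => if h == 0 then d else (f (z + h) - f z) / h); last first.
  apply: (@nearW _ (nbhs (0 : K))) => h.
  case: eqVneq => [->|h0]; first by rewrite addr0 subrr mulr0.
  by rewrite divfK.
apply/(@cvgrPdist_le _ _ _ (nbhs (0 : K))) => e e0; have [dl dl0 Hd] := H e e0.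
apply: (filterS _ (near0_lt dl0)) => h hd.
case: eqVneq => [_|h0]; first by rewrite subrr normr0 ltW.
rewrite distrC -(ler_pM2r (_ : 0 < `|h|)) ?normr_gt0 // -normrM mulrBl divfK //.
exact: Hd.
Qed.

Lemma has_derivative_cst c z : has_derivative (fun=> c) z 0.
Proof.
exists (fun=> 0); first by exact: cvg_cst0.
by apply: (@nearW _ (nbhs (0 : K))) => h; rewrite subrr mul0r.
Qed.

Lemma has_derivative_id z : has_derivative id z 1.
Proof.
exists (fun=> 1); first by exact: cvg_cst0.
by apply: (@nearW _ (nbhs (0 : K))) => h; rewrite mul1r addrC addKr.
Qed.

Lemma has_derivativeD f g z d e : has_derivative f z d -> has_derivative g z e ->
  has_derivative (fun w => f w + g w) z (d + e).
Proof.
move=> [p pd pE] [q qe qE]; exists (fun h => p h + q h); first exact: cvgD0.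
by near=> h; rewrite opprD addrACA mulrDl; congr (_ + _); near: h.
Unshelve. all: by end_near. Qed.

Lemma has_derivativeM f g z d e : has_derivative f z d -> has_derivative g z e ->
  has_derivative (fun w => f w * g w) z (d * g z + f z * e).
Proof.
move=> [p pd pE] [q qe qE].
exists (fun h => p h * (g z + q h * h) + f z * q h).
  apply: cvgD0; last by apply: cvgM0 => //; exact: cvg_cst0.
  apply: cvgM0 => //; have := cvgD0 (@cvg_cst0 (g z)) (cvgM0 qe cvg_id0).
  by rewrite mulr0 addr0.
near=> h.
have fE : f (z + h) - f z = p h * h by near: h.
have gE : g (z + h) - g z = q h * h by near: h.
rewrite -(subrK (f z) (f _)) -(subrK (g z) (g _)) fE gE; ring.
Unshelve. all: by end_near. Qed.

(** The quotient of the composite is [q (p h * h) * p h]. Since [q] is completed at [0], nothing is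
    divided by the increment of [f], which may vanish. *)
Lemma has_derivative_comp f g z d e :
  has_derivative f z d -> has_derivative g (f z) e ->
  has_derivative (fun w => g (f w)) z (e * d).
Proof.
move=> [p pd pE] [q qe qE].
have p0 : p h * h @[h --> (0 : K)] --> (0 : K).
  by have := cvgM0 pd cvg_id0; rewrite mulr0.
exists (fun h => q (p h * h) * p h).
  have qp : q (p h * h) @[h --> (0 : K)] --> e by move=> A /qe /p0.
  exact: (cvgM0 qp pd).
have qE' : \forall h \near (0 : K),
    g (f z + p h * h) - g (f z) = q (p h * h) * (p h * h).
  by move: qE => /p0.
near=> h.
have fE : f (z + h) - f z = p h * h by near: h.
rewrite -(subrK (f z) (f (z + h))) fE (addrC (_ * h)).
by rewrite -mulrA; near: h.
Unshelve. all: by end_near. Qed.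

Lemma has_derivativeV z : z != 0 -> has_derivative (fun w => w^-1) z (- (z * z)^-1).
Proof.
move=> z0; exists (fun h => - (z * (z + h))^-1).
  apply: cvgN0; apply: cvgV0; first by rewrite mulf_neq0.
  apply: (cvgM0 (@cvg_cst0 z)).
  by have := cvgD0 (@cvg_cst0 z) cvg_id0; rewrite addr0.
near=> h.
have zh0 : z + h != 0.
  have hz : `|h| < `|z| by near: h; apply: near0_lt; rewrite normr_gt0.
  by apply: contraTneq hz => /eqP; rewrite addr_eq0 => /eqP ->; rewrite normrN ltxx.
by field; rewrite z0 zh0.
Unshelve. all: by end_near. Qed.

Lemma has_derivative_eq f z d e : has_derivative f z d -> d = e ->
  has_derivative f z e.
Proof. by move=> ? <-. Qed.

Lemma has_derivative_near f g z d : has_derivative f z d ->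
  (exists2 r, 0 < r & forall h, `|h| < r -> f (z + h) = g (z + h)) ->
  has_derivative g z d.
Proof.
move=> [p pd pE] [r r0 fg]; exists p => //; near=> h.
rewrite -fg; last by near: h; exact: near0_lt.
by rewrite -[z in g z]addr0 -fg ?normr0 // addr0; near: h.
Unshelve. all: by end_near. Qed.

End HasDerivative.
Lemma has_derivativeN (K : numFieldType) (f : K -> K) (z d : K) :
  has_derivative f z d -> has_derivative (fun w => - f w) z (- d).
Proof.
rewrite !has_derivativeP => H e /H[dl dl0 Hd]; exists dl => // h /Hd.
by rewrite -normrN; congr (`|_| <= _); ring.
Qed.

(** * Real part, imaginary part and modulus of complex numbers *)

Section ComplexFacts.
Variable R : rcfType.
Implicit Types (z w : R[i]) (x y : R).
Local Notation normc := (@Normc.normc R).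

Lemma complex_ReD z w : Re (z + w) = Re z + Re w.
Proof. by case: z => a b; case: w => c d. Qed.
Lemma complex_ImD z w : Im (z + w) = Im z + Im w.
Proof. by case: z => a b; case: w => c d. Qed.
Lemma complex_ReN z : Re (- z) = - Re z. Proof. by case: z => a b. Qed.
Lemma complex_ImN z : Im (- z) = - Im z. Proof. by case: z => a b. Qed.
Lemma complex_ReM z w : Re (z * w) = Re z * Re w - Im z * Im w.
Proof. by case: z => a b; case: w => c d. Qed.
Lemma complex_ImM z w : Im (z * w) = Re z * Im w + Im z * Re w.
Proof. by case: z; case: w => a b c d /=; rewrite [c * b]mulrC mulrC addrC mulrC. Qed.

Lemma complex_ext z w : Re z = Re w -> Im z = Im w -> z = w.
Proof. by case: z; case: w => a b c d /= -> ->. Qed.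

(** The norm on [R[i]] takes its values in [R[i]]; [normc] is the modulus as an element of [R],
    where real arithmetic applies. *)
Lemma normr_normc z : `|z| = (normc z)%:C%C.
Proof. by []. Qed.

Lemma sqr_normcE z : normc z ^+ 2 = Re z ^+ 2 + Im z ^+ 2.
Proof. by case: z => a b /=; rewrite sqr_sqrtr // addr_ge0 ?sqr_ge0. Qed.

Lemma normc_ge0 z : 0 <= normc z.
Proof. by case: z => a b; exact: sqrtr_ge0. Qed.

Lemma normr_Re_le z : `|Re z| <= normc z.
Proof.
rewrite -(ler_pXn2r (_ : 0 < 2)%N) ?nnegrE ?normc_ge0 //.
by rewrite real_normK ?num_real // sqr_normcE lerDl sqr_ge0.
Qed.

Lemma normr_Im_le z : `|Im z| <= normc z.
Proof.
rewrite -(ler_pXn2r (_ : 0 < 2)%N) ?nnegrE ?normc_ge0 //.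
by rewrite real_normK ?num_real // sqr_normcE lerDr sqr_ge0.
Qed.

Lemma normc_le_add z : normc z <= `|Re z| + `|Im z|.
Proof.
rewrite -(ler_pXn2r (_ : 0 < 2)%N) ?nnegrE ?normc_ge0 ?addr_ge0 //.
rewrite sqr_normcE sqrrD !real_normK ?num_real // -addrA lerD2l lerDr.
by rewrite mulrn_wge0 // mulr_ge0.
Qed.

Lemma normc_real x : normc x%:C%C = `|x|.
Proof. by rewrite /= expr0n /= addr0 sqrtr_sqr. Qed.

Lemma normc_lt z x : 0 < x -> (`|z| < x%:C%C) = (normc z < x).
Proof. by rewrite ltcR. Qed.

Lemma gt0_real_complex z : 0 < z -> exists2 x, 0 < x & z = x%:C%C.
Proof. by case: z => a b; rewrite ltcE /= => /andP[/eqP -> a0]; exists a. Qed.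

End ComplexFacts.

(** * Complex derivatives restricted to real lines *)

Section ComplexDerivative.
Variable R : realType.
Implicit Types (f : R[i] -> R[i]) (z w d v : R[i]).
Local Notation normc := (@Normc.normc R).

(** Positive elements of [R[i]] are real, so the error and the radius can be taken in [R]. *)
Lemma has_derivative_complexP f z d : has_derivative f z d <->
  forall e : R, 0 < e -> exists2 dl : R, 0 < dl &
    forall h, normc h < dl -> normc (f (z + h) - f z - d * h) <= e * normc h.
Proof.
rewrite has_derivativeP; split=> H e e0.
  have [|dl dl0 Hd] := H e%:C%C; first by rewrite ltcR.
  have [x x0 xE] := gt0_real_complex dl0; exists x => // h hx.
  have := Hd h; rewrite xE normc_lt // => /(_ hx).
  by rewrite !normr_normc -rmorphM lecR.
have [x x0 ->] := gt0_real_complex e0.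
have [y y0 Hy] := H _ x0; exists y%:C%C; first by rewrite ltcR.
by move=> h; rewrite normc_lt // => /Hy; rewrite !normr_normc -rmorphM lecR.
Qed.

Lemma is_derive_Re f w v (t : R) d : has_derivative f (w + t%:C%C * v) d ->
  is_derive t (1 : R) (fun s => Re (f (w + s%:C%C * v))) (Re (d * v)).
Proof.
move=> /has_derivative_complexP H; apply: is_derive1_approx => e e0.
(* Using [1 + normc v] in place of [normc v] keeps the divisions valid when [v = 0]. *)
have v0 : 0 < 1 + normc v by rewrite ltr_pwDl // normc_ge0.
have [|dl dl0 Hd] := H (e / (1 + normc v)); first by rewrite divr_gt0.
exists (dl / (1 + normc v)); first by rewrite divr_gt0.
move=> h hd.
have nE : normc (h%:C%C * v) <= `|h| * (1 + normc v).
  by rewrite Normc.normcM normc_real ler_wpM2l // lerDr.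
have := Hd (h%:C%C * v) (le_lt_trans nE _); rewrite -ltr_pdivlMr // => /(_ hd).
have -> : w + t%:C%C * v + h%:C%C * v = w + (t + h)%:C%C * v.
  by rewrite rmorphD /= mulrDl addrA.
move=> /(le_trans (normr_Re_le _)).
rewrite !(complex_ReD, complex_ReN) (_ : Re (d * (h%:C%C * v)) = Re (d * v) * h); last first.
  by rewrite !(complex_ReM, complex_ImM) /=; ring.
move=> /le_trans; apply.
have -> : e * `|h| = e / (1 + normc v) * (`|h| * (1 + normc v)).
  by field; rewrite gt_eqF.
by rewrite ler_wpM2l // ltW // divr_gt0.
Qed.

(** The imaginary part of [f] is the real part of [- 'i * f]. *)
Lemma is_derive_Im f w v (t : R) d : has_derivative f (w + t%:C%C * v) d ->
  is_derive t (1 : R) (fun s => Im (f (w + s%:C%C * v))) (Im (d * v)).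
Proof.
move=> fd; have := has_derivativeM (has_derivative_cst (- 'i%C) (w + t%:C%C * v)) fd.
move=> /is_derive_Re.
rewrite mul0r add0r (_ : Re (- 'i%C * d * v) = Im (d * v)); last first.
  by rewrite -mulrA mulNr complex_ReN mulrC ReiNIm opprK.
congr is_derive; apply/funext => s.
by rewrite mulNr complex_ReN mulrC ReiNIm opprK.
Qed.

End ComplexDerivative.

(** * Comparison of two vertical lines for a periodic holomorphic function *)

Lemma continuous_primitive (R : realType) (f : R -> R) (a b : R) : a < b ->
  (forall x, a <= x <= b -> {for x, continuous f}) ->
  exists F : R -> R, forall x, a < x < b -> is_derive x (1 : R) F (f x).
Proof.
move=> ab fc.
have fi : (@lebesgue_measure R).-integrable `[a, b] (EFin \o f).
  apply: continuous_compact_integrable; first exact: segment_compact.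
  apply: continuous_in_subspaceT => x; rewrite inE /= in_itv /=.
  exact: fc.
exists (fun x => \int[@lebesgue_measure R]_(t in `[a, x]) f t)%R => x /andP[ax xb].
have [|dF FE] := continuous_FTC1_closed xb fi ax; first by apply: fc; rewrite !ltW.
by apply: DeriveDef; rewrite // -derive1E.
Qed.

Lemma derive_continuous (R : realType) (f : R -> R) (x d : R) :
  is_derive x (1 : R) f d -> {for x, continuous f}.
Proof.
by move=> [fd _]; apply: differentiable_continuous; apply/derivable1_diffP.
Qed.

(** With [A] and [B] the real and imaginary parts of [Q], the form [A dt + B ds] is the imaginary
    part of [Q(w) dw]. By periodicity the horizontal sides of the rectangle cancel, so [A] has equal
    integrals over the two vertical sides. *)
Lemma periodic_mean_eq (R : realType) (Q dQ : R[i] -> R[i]) (p s1 s2 : R) :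
  0 < p -> s1 < s2 < 0 ->
  (forall z : R[i], Re z < 0 -> has_derivative Q z (dQ z)) ->
  (forall s, Q (Complex s p) = Q (Complex s 0)) ->
  exists t, Re (Q (Complex s1 t)) = Re (Q (Complex s2 t)).
Proof.
move=> p0 /andP[s12 s20] QE Qp.
pose A s t := Re (Q (Complex s t)); pose B s t := Im (Q (Complex s t)).
have dA (s t : R) : s < 0 -> is_derive t (1 : R) (A s) (Re (dQ (Complex s t) * 'i%C)).
  move=> s0; have E x : Complex s x = Complex s 0 + x%:C%C * 'i%C.
    apply: complex_ext;
      by rewrite !(complex_ReD, complex_ImD, complex_ReM, complex_ImM) /=; ring.
  have -> : A s = fun x => Re (Q (Complex s 0 + x%:C%C * 'i%C)).
    by apply/funext => x; rewrite /A -E.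
  by apply: is_derive_Re; rewrite -E; exact: QE.
have dB (s t : R) : s < 0 -> is_derive s (1 : R) (B ^~ t) (Im (dQ (Complex s t) * 1)).
  move=> s0; have E x : Complex x t = Complex 0 t + x%:C%C * 1.
    apply: complex_ext;
      by rewrite !(complex_ReD, complex_ImD, complex_ReM, complex_ImM) /=; ring.
  have -> : B ^~ t = fun x => Im (Q (Complex 0 t + x%:C%C * 1)).
    by apply/funext => x; rewrite /B -E.
  by apply: is_derive_Im; rewrite -E; exact: QE.
have [PA HPA] : exists PA : R -> R -> R, forall s t : R, s < 0 -> 0 <= t <= p ->
    is_derive t (1 : R) (PA s) (A s t).
  have /choice[PA H] (s : R) : exists F : R -> R, s < 0 ->
      forall t : R, -1 < t < p + 1 -> is_derive t (1 : R) F (A s t).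
    have [s0|s0] := ltP s 0; last by exists (fun=> 0).
    (* Primitives are obtained on open intervals only, hence the margin around [[0, p]]. *)
    have [| |F HF] := @continuous_primitive R (A s) (- 1) (p + 1); first by lra.
      by move=> x _; exact: derive_continuous (dA s x s0).
    by exists F => _.
  by exists PA => s t s0 tI; apply: H => //; lra.
have [PB HPB] : exists PB : R -> R -> R, forall s t : R, s1 <= s <= s2 ->
    is_derive s (1 : R) (PB ^~ t) (B s t).
  have /choice[PB H] (t : R) : exists F : R -> R,
      forall s : R, s1 - 1 < s < s2 / 2 -> is_derive s (1 : R) F (B s t).
    (* The right end [s2 / 2] exceeds [s2] but remains negative, inside the domain of [Q]. *)
    have [| |F HF] := @continuous_primitive R (B ^~ t) (s1 - 1) (s2 / 2); first by lra.
      by move=> x xI; apply: derive_continuous (dB x t _); lra.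
    by exists F.
  by exists (fun s t => PB t s) => s t sI; apply: H; lra.
have G := @goursat R A B PA PB s1 s2 0 p s12 p0.
have {}G : (PA s2 p - PA s2 0) - (PA s1 p - PA s1 0) =
           (PB s2 p - PB s1 p) - (PB s2 0 - PB s1 0).
  apply: G => s t sI tI; [by apply: HPA => //; lra|exact: HPB|].
  have s0 : s < 0 by lra.
  set d := dQ (Complex s t).
  (* These are the Cauchy-Riemann equations; the shared slope is [Re d]. *)
  exists (Re d), (- Im d), (Im d) => e e0.
  have /has_derivative_complexP/(_ e e0)[dl dl0 Hd] := QE (Complex s t) s0.
  exists dl => // x y xyd.
  have := Hd (Complex (x - s) (y - t)).
  have nle : Normc.normc (Complex (x - s) (y - t)) <= `|x - s| + `|y - t|.
    exact: normc_le_add.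
  move=> /(_ (le_lt_trans nle xyd)).
  have -> : Complex s t + Complex (x - s) (y - t) = Complex x y.
    by apply: complex_ext; rewrite ?(complex_ReD, complex_ImD) /=; ring.
  set err := (X in Normc.normc X <= _) => /le_trans herr.
  have {}herr : Normc.normc err <= e * (`|x - s| + `|y - t|).
    by apply: herr; rewrite ler_pM2l.
  split; apply: le_trans herr.
    have -> : A x y - A s t - (Re d * (x - s) + - Im d * (y - t)) = Re err.
      by rewrite /err /A /d !(complex_ReD, complex_ReN, complex_ReM) /=; ring.
    exact: normr_Re_le.
  have -> : B x y - B s t - (Im d * (x - s) + Re d * (y - t)) = Im err.
    by rewrite /err /B /d !(complex_ImD, complex_ImN, complex_ImM) /=; ring.
  exact: normr_Im_le.
(* The derivative of this difference vanishes by periodicity, so the horizontal sides contribute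
   nothing. *)
have [t tI|x _] := MVT_cc s12 (f := fun s => PB s p - PB s 0)
    (df := fun s => B s p - B s 0).
  by apply: is_deriveB; apply: HPB.
rewrite /B Qp subrr mul0r => PBE.
have [t tI|t tI] := MVT_cc p0 (f := fun t => PA s2 t - PA s1 t)
    (df := fun t => A s2 t - A s1 t).
  by apply: is_deriveB; apply: HPA => //; lra.
rewrite subr0 => PAE; exists t; apply/eqP; rewrite eq_sym -subr_eq0.
have : (A s2 t - A s1 t) * p = 0 by lra.
by move=> /eqP; rewrite mulf_eq0 (gt_eqF p0) orbF.
Qed.

(** * The complex exponential *)

Definition cexp (R : realType) (z : R[i]) : R[i] :=
  Complex (expR (Re z) * cos (Im z)) (expR (Re z) * sin (Im z)).

Section ComplexExponential.
Variable R : realType.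
Implicit Types z w : R[i].
Local Notation normc := (@Normc.normc R).

Lemma cexpD z w : cexp (z + w) = cexp z * cexp w.
Proof.
apply: complex_ext; rewrite /= ?(complex_ReM, complex_ImM) complex_ReD complex_ImD;
  by rewrite expRD ?sinD ?cosD /=; ring.
Qed.

Lemma normc_cexp z : normc (cexp z) = expR (Re z).
Proof.
rewrite /= !exprMn -mulrDr cos2Dsin2 mulr1 sqrtr_sqr ger0_norm //.
Qed.

Lemma has_derivative_cexp0 : has_derivative (@cexp R) 0 1.
Proof.
apply/has_derivative_complexP => e e0.
(* The error splits into four terms bounded by [1], [3], [3] and [2] times [n * N], hence the [9];
   the condition [n <= 1] yields [expR x <= 3]. *)
have [n [n0 ne n1]] : exists n : R, [/\ 0 < n, n <= e / 9 & n <= 1].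
  exists (Num.min (e / 9) 1).
  by split; rewrite ?lt_min ?ge_min ?lexx ?orbT // ltr01 divr_gt0.
have [d1 d10 H1] := approx_is_derive1 (is_derive_expR (0 : R)) n0.
have [d2 d20 H2] := approx_is_derive1 (is_derive_cos (0 : R)) n0.
have [d3 d30 H3] := approx_is_derive1 (is_derive_sin (0 : R)) n0.
exists (Num.min (Num.min d1 n) (Num.min d2 d3)) => [|[x y]].
  by rewrite !lt_min d10 n0 d20 d30.
rewrite !lt_min => /andP[/andP[hd1 hdn] /andP[hd2 hd3]].
have xh := normr_Re_le (Complex x y); have yh := normr_Im_le (Complex x y).
set N := normc _ in hd1 hdn hd2 hd3 xh yh *.
apply: le_trans (normc_le_add _) _.
have N0 : 0 <= N := normc_ge0 _.
rewrite !(complex_ReD, complex_ImD, complex_ReN, complex_ImN, complex_ReM, complex_ImM) /=.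
move: N xh yh hd1 hdn hd2 hd3 N0 => N /= xh yh hd1 hdn hd2 hd3 N0.
have {H1} := H1 _ (le_lt_trans xh hd1).
have {H2} := H2 _ (le_lt_trans yh hd2).
have {H3} := H3 _ (le_lt_trans yh hd3).
rewrite !add0r expR0 sin0 cos0 oppr0 mul0r !mul1r !subr0 addr0.
move=> Hs Hc Hx.
have x1 : `|x| <= 1 by apply: le_trans xh (le_trans (ltW hdn) n1).
have e2 : expR x <= 3.
  have nx1 : n * `|x| <= 1 by apply: mulr_ile1 => //; exact: ltW.
  by move: (le_trans Hx nx1) x1; clear; rewrite !ler_norml; lra.
rewrite ?mul1r ?mulr0 ?mul0r ?subr0 ?addr0 ?oppr0 ?addr0.
have e0' := expR_gt0 x.
have -> : expR x * cos y - 1 - x = (expR x - 1 - x) + expR x * (cos y - 1) by ring.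
have -> : expR x * sin y - y = expR x * (sin y - y) + (expR x - 1) * y by ring.
have b1 : `|expR x - 1 - x| <= n * N by apply: le_trans Hx _; rewrite ler_pM2l.
have b2 : `|expR x * (cos y - 1)| <= 3 * (n * N).
  rewrite normrM (gtr0_norm e0') ler_pM ?(ltW e0') //.
  by apply: le_trans Hc _; rewrite ler_pM2l.
have b3 : `|expR x * (sin y - y)| <= 3 * (n * N).
  rewrite normrM (gtr0_norm e0') ler_pM ?(ltW e0') //.
  by apply: le_trans Hs _; rewrite ler_pM2l.
have b4 : `|(expR x - 1) * y| <= 2 * n * N.
  rewrite normrM ler_pM //.
  have : n * `|x| <= n by rewrite ler_piMr // ltW.
  move=> /(le_trans Hx); move: (le_lt_trans xh hdn); clear.
  by rewrite !ler_norml ltr_norml; lra.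
have := ler_normD (expR x - 1 - x) (expR x * (cos y - 1)).
have := ler_normD (expR x * (sin y - y)) ((expR x - 1) * y).
have : 9 * (n * N) <= e * N.
  by rewrite mulrA ler_wpM2r //; move: ne; clear; lra.
move: b1 b2 b3 b4; clear; lra.
Qed.

(** The addition law carries the derivative at [0] to [z]. *)
Lemma has_derivative_cexp z : has_derivative (@cexp R) z (cexp z).
Proof.
have H : has_derivative (fun w => cexp z * cexp (w - z)) z (cexp z).
  apply: has_derivative_eq.
    apply: has_derivativeM; first exact: has_derivative_cst.
    apply: (has_derivative_comp (f := fun w => w - z) (g := @cexp R)).
      by apply: has_derivativeD; [exact: has_derivative_id|exact: has_derivative_cst].
    by rewrite subrr; exact: has_derivative_cexp0.
  by rewrite mul0r add0r addr0 !mulr1.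
by apply: has_derivative_near H _; exists 1 => // h _; rewrite -cexpD addrC subrK.
Qed.

End ComplexExponential.

(** * A minimum principle and the derivative bound at the centre of the disk *)

Section DiskAndHalfPlane.
Variable R : realType.
Implicit Types (f h k q : R[i] -> R[i]) (z w d : R[i]).
Local Notation normc := (@Normc.normc R).

Lemma normc_gt0 z : (0 < normc z) = (z != 0).
Proof.
rewrite lt_def normc_ge0 andbT; congr (~~ _); apply/eqP/eqP => [|->].
  exact: Normc.eq0_normc.
exact: Normc.normc0.
Qed.

Lemma normc_triangle z w : normc (z + w) <= normc z + normc w.
Proof. exact: le_normcD. Qed.

Lemma has_derivative_continuous f z d : has_derivative f z d ->
  forall e : R, 0 < e -> exists2 dl : R, 0 < dl &
    forall y, normc y < dl -> normc (f (z + y) - f z) <= e.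
Proof.
move=> /has_derivative_complexP/(_ 1 ltr01)[dl dl0 Hd] e e0.
have d0 : 0 < 1 + normc d by rewrite ltr_pwDl // normc_ge0.
exists (Num.min dl (e / (1 + normc d))); first by rewrite lt_min dl0 divr_gt0.
move=> y; rewrite lt_min ltr_pdivlMr // => /andP[/Hd yd ye].
rewrite -[X in normc X](subrK (d * y)).
apply: le_trans (normc_triangle _ _) _; rewrite Normc.normcM.
by move: yd ye; lra.
Qed.

(** If [Re (q 0)] were negative, continuity would keep [Re q] negative on a small circle of radius
    [m]; yet [Re q] takes a common value on that circle and on the one of radius [r]. Asking only
    continuity at [0] admits functions containing a difference quotient completed there. *)
Lemma Re_ge0_center q (r : R) : 0 < r < 1 ->
  (forall z, 0 < normc z < 1 -> exists d, has_derivative q z d) ->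
  (forall e : R, 0 < e -> exists2 dl : R, 0 < dl &
    forall z, normc z < dl -> normc (q z - q 0) <= e) ->
  (forall z, normc z = r -> 0 <= Re (q z)) ->
  0 <= Re (q 0).
Proof.
move=> /andP[r0 r1] qd qc qr; rewrite leNgt; apply/negP => q0.
have [|dl dl0 Hd] := qc (- Re (q 0) / 2); first by lra.
pose m := Num.min (dl / 2) (r / 2).
have m0 : 0 < m by rewrite lt_min; apply/andP; split; lra.
have mdl : m < dl by rewrite gt_min; apply/orP; left; lra.
have mr : m < r by rewrite gt_min; apply/orP; right; lra.
clearbody m.
(* Outside the left half-plane the value [0] is a dummy that makes [dQ] total. *)
have /choice[dQ HdQ] z : exists d, Re z < 0 -> has_derivative (fun w => q (cexp w)) z d.
  have [z0|z0] := ltP (Re z) 0; last by exists 0.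
  have [|d qzd] := qd (cexp z).
    by rewrite normc_cexp expR_gt0 expR_lt1.
  by exists (d * cexp z) => _; apply: has_derivative_comp qzd; exact: has_derivative_cexp.
(* [cexp] wraps the vertical lines at [ln m] and [ln r] onto the circles of radii [m] and [r]. *)
have [||s|t] := @periodic_mean_eq R _ dQ (2 * pi) (ln m) (ln r) _ _ HdQ.
- by rewrite mulr_gt0 // pi_gt0.
- by rewrite ltr_ln ?posrE // mr ln_lt0 // r0 r1.
- by rewrite /cexp /= cos0 sin0 mulr_natl cos2pi sin2pi.
have h1 : 0 <= Re (q (cexp (Complex (ln r) t))).
  by apply: qr; rewrite normc_cexp /= lnK.
have h2 := Hd (cexp (Complex (ln m) t)).
rewrite normc_cexp /= lnK ?posrE // in h2.
have := le_trans (normr_Re_le _) (h2 mdl).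
by rewrite complex_ReD complex_ReN ler_norml; lra.
Qed.

Lemma invc_unit w : normc w = 1 -> w^-1 = Complex (Re w) (- Im w).
Proof.
move=> w1; have w0 : w != 0 by rewrite -normc_gt0 w1.
apply: (mulfI w0); rewrite mulfV //.
have := sqr_normcE w; rewrite w1 expr1n => E.
by apply: complex_ext; rewrite ?(complex_ReM, complex_ImM) /=; lra.
Qed.

(* On [|z| = |w|] the factor [2 - z / w - w / z] is real and nonnegative, and
   the real part of [q] below equals this factor times [Re (k z)]. *)
Lemma Re_derivative_le k d w : 0 < normc w < 1 ->
  (forall z, normc z < 1 -> exists d, has_derivative k z d) ->
  (forall z, normc z < 1 -> 0 <= Re (k z)) ->
  has_derivative k 0 d -> Re (w * d) <= 2 * Re (k 0).
Proof.
move=> wI kd kge0 k0d; have [w0 w1] := andP wI.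
have wn0 : w != 0 by rewrite -normc_gt0.
(* [sl] is the difference quotient, continuous at [0] once completed by [d]. The terms are arranged
   so that [q 0 = 2 * Re (k 0) - w * d], and [0 <= Re (q 0)] is the claim. *)
pose sl z := if z == 0 then d else (k z - k 0) * z^-1.
pose q1 z := (2 - w^-1 * z) * (k z - k 0) + (2 * Re (k 0))%:C%C * (1 - w^-1 * z).
pose q z := q1 z + (- w) * sl z.
have q1d z : normc z < 1 -> exists d, has_derivative q1 z d.
  move=> /kd[e ke]; eexists; apply: has_derivativeD; apply: has_derivativeM.
  - apply: has_derivativeD; first exact: has_derivative_cst.
    by apply: has_derivativeN; apply: has_derivativeM;
      [exact: has_derivative_cst|exact: has_derivative_id].
  - by apply: has_derivativeD; [exact: ke|exact: has_derivative_cst].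
  - exact: has_derivative_cst.
  - apply: has_derivativeD; first exact: has_derivative_cst.
    by apply: has_derivativeN; apply: has_derivativeM;
      [exact: has_derivative_cst|exact: has_derivative_id].
have sld z : 0 < normc z < 1 -> exists d, has_derivative sl z d.
  rewrite normc_gt0 => /andP[z0 /kd[e ke]]; eexists.
  apply: (@has_derivative_near _ (fun z => (k z - k 0) * z^-1)).
    apply: has_derivativeM; last exact: has_derivativeV.
    by apply: has_derivativeD; [exact: ke|exact: has_derivative_cst].
  exists `|z|; rewrite ?normr_gt0 // => y yz; rewrite /sl.
  case: eqVneq => // /eqP; rewrite addr_eq0 => /eqP zy.
  by move: yz; rewrite zy normrN ltxx.
have : 0 <= Re (q 0).
  apply: (Re_ge0_center wI).
  - move=> z zI; have [e1 H1] := q1d z (proj2 (andP zI)); have [e2 H2] := sld z zI.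
    eexists; apply: has_derivativeD; first exact: H1.
    by apply: has_derivativeM; [exact: has_derivative_cst|exact: H2].
  - move=> e e0.
    have [|e1 H1] := q1d 0; first by rewrite Normc.normc0.
    have [|d1 d10 H1'] := has_derivative_continuous H1 (e := e / 2); first by lra.
    have /has_derivative_complexP/(_ (e / 2))[|d2 d20 H2] := k0d; first by lra.
    exists (Num.min d1 d2); first by rewrite lt_min d10.
    move=> z; rewrite lt_min => /andP[/H1' z1 /H2 z2].
    rewrite !add0r in z1 z2.
    have -> : q z - q 0 = (q1 z - q1 0) + (- w) * (sl z - sl 0).
      by rewrite /q; ring.
    apply: le_trans (normc_triangle _ _) _.
    have : normc (sl z - sl 0) <= e / 2.
      rewrite /sl eqxx; case: eqVneq => [_|z0].
        by rewrite subrr Normc.normc0; lra.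
      rewrite (_ : _ - d = (k z - k 0 - d * z) * z^-1); last by field.
      by rewrite Normc.normcM Normc.normcV ler_pdivrMr ?normc_gt0.
    rewrite Normc.normcM (normcN w) => hs.
    have : normc w * normc (sl z - sl 0) <= e / 2.
      by rewrite -[leRHS]mul1r ler_pM ?normc_ge0 // ltW.
    by move: z1; lra.
  - move=> z zw; have z0 : z != 0 by rewrite -normc_gt0 zw.
    have u1 : normc (z / w) = 1 by rewrite Normc.normcM Normc.normcV zw mulfV // gt_eqF.
    have uV := invc_unit u1.
    have -> : q z = (2 - z / w - (z / w)^-1) * (k z - k 0)
                    + (2 * Re (k 0))%:C%C * (1 - z / w).
      by rewrite /q /q1 /sl (negPf z0); field; rewrite z0 wn0.
    rewrite uV; move: (z / w) u1 => u u1.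
    have := sqr_normcE u; rewrite u1 => E.
    have u2 : Re u <= 1 by have := normr_Re_le u; rewrite u1 ler_norml; lra.
    rewrite !(complex_ReD, complex_ReN, complex_ReM, complex_ImD, complex_ImN) /=.
    have := kge0 z; rewrite zw => /(_ w1) kz.
    rewrite (_ : _ + _ = (2 - 2 * Re u) * Re (k z)); last by ring.
    by rewrite mulr_ge0 //; lra.
rewrite /q /q1 /sl eqxx mulr0 !subr0 subrr mulr0 add0r mulr1 mulNr.
by rewrite complex_ReD complex_ReN subr_ge0 /=.
Qed.

(** Choosing [w] as [s * normc d / d] with [s < 1] makes [w * d] the positive number [s * normc d],
    to which the previous bound applies. *)
Lemma normc_derivative_le k d :
  (forall z, normc z < 1 -> exists d, has_derivative k z d) ->
  (forall z, normc z < 1 -> 0 <= Re (k z)) ->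
  has_derivative k 0 d -> normc d <= 2 * Re (k 0).
Proof.
move=> kd k0 kd0; have K0 : 0 <= Re (k 0) by apply: k0; rewrite Normc.normc0.
rewrite leNgt; apply/negP => dk.
have d0 : 0 < normc d by lra.
have dn0 : d != 0 by rewrite -normc_gt0.
(* Then [s * normc d] is the midpoint of [2 * Re (k 0)] and [normc d], still above
   [2 * Re (k 0)]. *)
pose s := (2 * Re (k 0) + normc d) / (2 * normc d).
have s0 : 0 < s by rewrite divr_gt0 //; lra.
have s1 : s < 1 by rewrite ltr_pdivrMr; lra.
have := @Re_derivative_le k d ((s * normc d)%:C%C / d).
have -> : normc ((s * normc d)%:C%C / d) = s.
  rewrite Normc.normcM normc_real Normc.normcV ger0_norm ?mulfK ?gt_eqF //.
  by rewrite mulr_ge0 ?normc_ge0 // ltW.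
rewrite s0 s1 => /(_ isT kd k0 kd0); rewrite divfK //=.
rewrite (_ : s * normc d = (2 * Re (k 0) + normc d) / 2); first by lra.
by rewrite /s; field; rewrite gt_eqF.
Qed.

End DiskAndHalfPlane.

(** * Schwarz-Pick and rigidity on the right half-plane *)

Section HalfPlane.
Variable R : realType.
Implicit Types (f h : R[i] -> R[i]) (z w d : R[i]).
Local Notation normc := (@Normc.normc R).

Lemma Re_div z w : w != 0 ->
  Re (z / w) = (Re z * Re w + Im z * Im w) / normc w ^+ 2.
Proof.
move=> w0; have n0 : normc w ^+ 2 != 0 by rewrite sqrf_eq0 gt_eqF // normc_gt0.
apply: (mulIf n0); rewrite divfK //.
rewrite -[in RHS](divfK w0 z); move: (z / w) => y.
by rewrite sqr_normcE complex_ReM complex_ImM; ring.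
Qed.

Lemma normc_lt1_neq1 z : normc z < 1 -> 1 - z != 0.
Proof. by apply: contraTneq => /subr0_eq <-; rewrite Normc.normc1 ltxx. Qed.

Lemma Re_cayley_gt0 z : normc z < 1 -> 0 < Re ((1 + z) / (1 - z)).
Proof.
move=> z1; have n0 := normc_lt1_neq1 z1.
rewrite Re_div // divr_gt0 ?exprn_gt0 ?normc_gt0 //.
rewrite !(complex_ReD, complex_ImD, complex_ReN, complex_ImN) /=.
have : normc z ^+ 2 < 1 by rewrite expr_lt1 ?normc_ge0.
by rewrite sqr_normcE; lra.
Qed.

Lemma halfplane_addr1_neq0 w : 0 < Re w -> w + 1 != 0.
Proof.
by apply: contraTneq => /(congr1 (fun z => Re z)); rewrite complex_ReD /=; lra.
Qed.

Lemma normc_cayley_inv_lt1 w : 0 < Re w -> normc ((w - 1) / (w + 1)) < 1.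
Proof.
move=> w0; have n0 := halfplane_addr1_neq0 w0.
rewrite Normc.normcM Normc.normcV ltr_pdivrMr ?normc_gt0 // mul1r.
rewrite -(ltr_pXn2r (_ : 0 < 2)%N) ?nnegrE ?normc_ge0 // !sqr_normcE.
by rewrite !(complex_ReD, complex_ImD, complex_ReN, complex_ImN) /=; nra.
Qed.

(** The Cayley-type map [m] sends the disk into the half-plane, [0] to [w], and has derivative
    [2 * Re w] at [0]; the disk bound for [h] composed with [m] gives the claim. *)
Lemma halfplane_derivative_le h w d :
  (forall w, 0 < Re w -> exists d, has_derivative h w d) ->
  (forall w, 0 < Re w -> 0 <= Re (h w)) ->
  0 < Re w -> has_derivative h w d -> normc d * Re w <= Re (h w).
Proof.
move=> hd h0 w0 hwd.
pose m z := (Re w)%:C%C * ((1 + z) / (1 - z)) + Complex 0 (Im w).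
have m0 : m 0 = w.
  by rewrite /m addr0 subr0 divr1 mulr1; apply: complex_ext;
    rewrite ?(complex_ReD, complex_ImD) /=; ring.
have md z : normc z < 1 ->
    has_derivative m z ((Re w)%:C%C * (2 / (1 - z) ^+ 2)).
  move=> z1; have n0 := normc_lt1_neq1 z1.
  have D1 : has_derivative (fun z => 1 - z) z (- 1).
    apply: has_derivative_eq (has_derivativeD (has_derivative_cst _ _)
      (has_derivativeN (has_derivative_id z))) _.
    by rewrite add0r.
  have D2 := has_derivativeD (has_derivative_cst 1 z) (has_derivative_id z).
  have D3 := has_derivative_comp D1 (has_derivativeV n0).
  have D4 := has_derivativeM (has_derivative_cst (Re w)%:C%C z) (has_derivativeM D2 D3).
  apply: has_derivative_eq (has_derivativeD D4 (has_derivative_cst (Complex 0 (Im w)) z)) _.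
  by field.
have mRe z : normc z < 1 -> 0 < Re (m z).
  move=> /Re_cayley_gt0 z1; rewrite /m complex_ReD complex_ReM /= mul0r subr0 addr0.
  exact: mulr_gt0.
have kd : has_derivative (fun z => h (m z)) 0 (d * ((Re w)%:C%C * (2 / (1 - 0) ^+ 2))).
  by apply: has_derivative_comp; [apply: md; rewrite Normc.normc0|rewrite m0].
have := @normc_derivative_le _ (fun z => h (m z)) _ _ _ kd.
rewrite m0 subr0 expr1n divr1 !Normc.normcM normc_real (gtr0_norm w0).
rewrite (_ : normc 2 = 2); last by rewrite /= addr0 expr0n addr0 sqrtr_sqr ger0_norm.
move=> H; suff : normc d * (Re w * 2) <= 2 * Re (h w) by lra.
apply: H => z z1; last by apply: h0; exact: mRe.
have [e he] := hd _ (mRe _ z1).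
by eexists; exact: has_derivative_comp (md _ z1) he.
Qed.

(* Both [h] and [N w - h] have nonnegative real part, so [|h'|] and [|N - h'|]
   are bounded by quantities whose sum is [N]. *)
Lemma halfplane_derivative_real h (N : R) w d :
  (forall w, 0 < Re w -> exists d, has_derivative h w d) ->
  (forall w, 0 < Re w -> 0 <= Re (h w) <= N * Re w) ->
  0 < Re w -> has_derivative h w d -> d = (Re (h w) / Re w)%:C%C.
Proof.
move=> hd hN w0 hwd.
have h1 : normc d * Re w <= Re (h w).
  by apply: halfplane_derivative_le => // y /hN /andP[].
have gD y e : has_derivative h y e ->
    has_derivative (fun w => N%:C%C * w - h w) y (N%:C%C - e).
  move=> he; apply: has_derivative_eq
    (has_derivativeD (has_derivativeM (has_derivative_cst N%:C%C y) (has_derivative_id y))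
       (has_derivativeN he)) _.
  by rewrite mul0r add0r mulr1.
have h2 : normc (N%:C%C - d) * Re w <= N * Re w - Re (h w).
  have ReE y : Re (N%:C%C * y - h y) = N * Re y - Re (h y).
    by rewrite complex_ReD complex_ReN complex_ReM /= mul0r subr0.
  rewrite -ReE; apply: (halfplane_derivative_le (h := fun w => N%:C%C * w - h w)) => //.
  - by move=> y /hd[e he]; exists (N%:C%C - e); exact: gD.
  - by move=> y /hN; rewrite ReE; lra.
  - exact: gD.
have n0 : 0 <= Re (h w) / Re w.
  by have /andP[? _] := hN w w0; rewrite divr_ge0 // ltW.
rewrite -ler_pdivlMr // in h1.
have {}h2 : normc (N%:C%C - d) <= N - Re (h w) / Re w.
  rewrite -(ler_pM2r w0) mulrBl divfK ?gt_eqF //.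
(* Put [u = Re (h w) / Re w]. From [normc d <= u] follows [Re d <= u], and the bound on [N - d]
   gives [Re d >= u]; then [normc d <= u] leaves no room for an imaginary part. *)
have r1 := normr_Re_le d; have r2 := normr_Re_le (N%:C%C - d).
rewrite complex_ReD complex_ReN /= in r2.
have dE : Re d = Re (h w) / Re w.
  move: (Re (h w) / Re w) h1 h2 r1 r2 => u h1 h2; rewrite !ler_norml; lra.
apply: complex_ext; first by rewrite dE.
have : Re d ^+ 2 + Im d ^+ 2 <= (Re (h w) / Re w) ^+ 2.
  by rewrite -sqr_normcE ler_pXn2r ?nnegrE ?normc_ge0.
rewrite dE gerDl => d2; apply/eqP; rewrite -sqrf_eq0 eq_le d2 /=.
exact: sqr_ge0.
Qed.

Lemma Re_segment_eq f w v :
  (forall t : R, 0 <= t <= 1 ->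
     exists2 d, has_derivative f (w + t%:C%C * v) d & Re (d * v) = 0) ->
  Re (f (w + v)) = Re (f w).
Proof.
move=> fd.
have [t tI|t _] := MVT_cc (@ltr01 R) (f := fun s : R => Re (f (w + s%:C%C * v)))
    (df := fun=> 0).
  by have [d fdd <-] := fd t tI; exact: is_derive_Re.
rewrite mul0r mul1r mul0r addr0 => /eqP.
by rewrite subr_eq0 => /eqP.
Qed.

Lemma Re_segment_gt0 w v (t : R) : 0 < Re w -> 0 < Re (w + v) -> 0 <= t <= 1 ->
  0 < Re (w + t%:C%C * v).
Proof.
rewrite !(complex_ReD, complex_ReM) /= => w0 wv /andP[t0 t1].
have [h|h] := leP 0 (Re v).
  have := mulr_ge0 t0 h; lra.
have : 0 <= (1 - t) * - Re v by rewrite mulr_ge0; lra.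
lra.
Qed.

Lemma halfplane_derivative0 f w w' :
  (forall w, 0 < Re w -> has_derivative f w 0) ->
  0 < Re w -> 0 < Re w' -> f w' = f w.
Proof.
move=> fd w0 w'0; have wE : w' = w + (w' - w) by rewrite addrC subrK.
have sI t : 0 <= t <= 1 -> 0 < Re (w + t%:C%C * (w' - w)).
  by apply: Re_segment_gt0; rewrite // -wE.
apply: complex_ext.
  rewrite wE; apply: Re_segment_eq => t tI; exists 0; last by rewrite mul0r.
  by apply: fd; exact: sI.
have ImE z : Im z = Re (- 'i%C * z) by rewrite mulNr complex_ReN mulrC ReiNIm opprK.
rewrite !ImE wE; apply: (@Re_segment_eq (fun z => - 'i%C * f z)) => t tI.
exists 0; last by rewrite mul0r.
have := has_derivativeM (has_derivative_cst (- 'i%C) _) (fd _ (sI _ tI)).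
by rewrite mul0r mulr0 addr0.
Qed.

(** The derivative of [h] at [w] is the real number [Re (h w) / Re w]. This quotient is shown
    constant along vertical lines and then along the real axis, so [h] has constant derivative
    [c]. *)
Lemma halfplane_rigidity h (N : R) :
  (forall w, 0 < Re w -> exists d, has_derivative h w d) ->
  (forall w, 0 < Re w -> 0 <= Re (h w) <= N * Re w) ->
  exists c b : R, forall w, 0 < Re w -> h w = c%:C%C * w + Complex 0 b.
Proof.
move=> hd hN.
have hE w : 0 < Re w -> has_derivative h w (Re (h w) / Re w)%:C%C.
  move=> w0; have [d hwd] := hd w w0.
  by rewrite -(halfplane_derivative_real hd hN w0 hwd).
(* A real derivative times a purely imaginary direction has real part [0]. *)
have vert (x y : R) : 0 < x -> Re (h (Complex x y)) = Re (h x%:C%C).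
  move=> x0; have -> : Complex x y = x%:C%C + Complex 0 y.
    by apply: complex_ext; rewrite ?(complex_ReD, complex_ImD) /=; ring.
  apply: Re_segment_eq => t _; eexists.
    by apply: hE; rewrite complex_ReD complex_ReM /=; lra.
  by rewrite complex_ReM /=; ring.
(* At a real point [y] the derivative of [h w / w] is [Re (h y) / y ^+ 2 - h y / y ^+ 2], whose real
   part vanishes. *)
have horiz (x : R) : 0 < x -> Re (h x%:C%C) / x = Re (h 1).
  move=> x0; have := @Re_segment_eq (fun w => h w * w^-1) 1 (x - 1)%:C%C.
  have -> : 1 + (x - 1)%:C%C = x%:C%C by rewrite rmorphB /= addrC subrK.
  have ReE (y : R) : 0 < y -> Re (h y%:C%C * (y%:C%C)^-1) = Re (h y%:C%C) / y.
    move=> y0; rewrite Re_div ?normc_real; last by rewrite -normc_gt0 normc_real gtr0_norm.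
    by rewrite /= mulr0 addr0 gtr0_norm //; field; rewrite gt_eqF.
  rewrite ReE // invr1 mulr1; apply => t tI.
  have -> : 1 + t%:C%C * (x - 1)%:C%C = (1 + t * (x - 1))%:C%C.
    apply: complex_ext;
      by rewrite !(complex_ReD, complex_ImD, complex_ReM, complex_ImM) /=; ring.
  have y0 : 0 < 1 + t * (x - 1).
    move: tI => /andP[]; rewrite le_eqVlt => /orP[/eqP <- _|t0 t1]; first by lra.
    have : 0 < t * x by rewrite mulr_gt0.
    by lra.
  move: (1 + _) y0 => y y0.
  have yn0 : y%:C%C != 0 :> R[i] by rewrite -normc_gt0 normc_real gtr0_norm.
  eexists; first by apply: has_derivativeM; [exact: hE|exact: has_derivativeV].
  rewrite -!rmorphM -!fmorphV -rmorphN /=; move: (h y%:C%C) => a.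
  rewrite !(complex_ReM, complex_ReD, complex_ImM, complex_ImD) /=.
  by field; rewrite gt_eqF.
pose c := Re (h 1).
have hc w : 0 < Re w -> has_derivative h w c%:C%C.
  move=> w0; apply: has_derivative_eq (hE w w0) _; congr (_%:C%C).
  by rewrite -[w in h w](_ : Complex (Re w) (Im w) = w) ?vert ?horiz //; case: (w).
exists c, (Im (h 1)) => w w0.
have := @halfplane_derivative0 (fun w => h w - c%:C%C * w) 1 w _ ltr01 w0.
have D y : 0 < Re y -> has_derivative (fun w => h w - c%:C%C * w) y 0.
  move=> y0; apply: has_derivative_eq (has_derivativeD (hc y y0) (has_derivativeN
    (has_derivativeM (has_derivative_cst c%:C%C y) (has_derivative_id y)))) _.
  by rewrite mul0r add0r mulr1 subrr.
move=> /(_ D) /eqP; rewrite mulr1 subr_eq => /eqP ->; rewrite addrC.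
congr (_ + _); apply: complex_ext;
  rewrite ?(complex_ReD, complex_ImD, complex_ReN, complex_ImN) /= ?subrr ?subr0 //.
Qed.

(** Here [s] is the inverse Cayley map and [2^-1 * (w + 1)] equals [1 / (1 - s w)]. Rigidity makes
    [h] affine, and comparison with its expression through [f] determines both parts of [f]. *)
Lemma scalar_rigidity f (N : R) :
  (forall z, normc z < 1 -> 0 <= Re (f z) <= N) ->
  (forall z, normc z < 1 ->
     exists d, has_derivative (fun z => f z + z * conjc (f z)) z d) ->
  forall z z', normc z < 1 -> normc z' < 1 -> f z = f z'.
Proof.
move=> fN fd.
pose s w := (w - 1) / (w + 1).
pose g z := f z + z * conjc (f z).
pose h w := 2^-1 * (w + 1) * g (s w).
(* Writing [f (s w)] as [u + i v], the sum [(w + 1) (u + i v) + (w - 1) (u - i v)] collapses to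
   [2 (u w + i v)]. *)
have hE w : 0 < Re w -> h w = (Re (f (s w)))%:C%C * w + Complex 0 (Im (f (s w))).
  move=> w0; have n0 := halfplane_addr1_neq0 w0.
  have -> : h w = 2^-1 * ((w + 1) * f (s w) + (w - 1) * conjc (f (s w))).
    by rewrite /h /g {2}/s; field.
  have -> : f (s w) = (Re (f (s w)))%:C%C + Complex 0 (Im (f (s w))).
    by apply: complex_ext; rewrite ?(complex_ReD, complex_ImD) /=; ring.
  move: (Re _) (Im _) => u v.
  have -> : conjc (u%:C%C + Complex 0 v) = u%:C%C - Complex 0 v.
    by apply: complex_ext;
      rewrite /= ?(complex_ReD, complex_ImD, complex_ReN, complex_ImN) /=; ring.
  have -> : Re (u%:C%C + Complex 0 v) = u by rewrite complex_ReD /= addr0.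
  have -> : Im (u%:C%C + Complex 0 v) = v by rewrite complex_ImD /= add0r.
  by field.
have [||c [b hb]] := @halfplane_rigidity h N.
- move=> w w0; have n0 := halfplane_addr1_neq0 w0.
  have [e ge] := fd _ (normc_cayley_inv_lt1 w0).
  have D1 y := has_derivativeD (has_derivative_id w) (has_derivative_cst y w).
  have D2 := has_derivativeM (D1 (- 1)) (has_derivative_comp (D1 1) (has_derivativeV n0)).
  eexists; apply: has_derivativeM; first by apply: has_derivativeM;
    [exact: has_derivative_cst|exact: D1].
  exact: (has_derivative_comp (g := g) D2 ge).
- move=> w w0; rewrite hE // complex_ReD complex_ReM /= mul0r subr0 addr0.
  have /andP[u0 uN] := fN _ (normc_cayley_inv_lt1 w0).
  by rewrite mulr_ge0 ?(ltW w0) // ler_pM2r.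
suff main z : normc z < 1 -> f z = Complex c b.
  by move=> z z' z1 z'1; rewrite !main.
move=> z1; have n0 := normc_lt1_neq1 z1.
have w0 := Re_cayley_gt0 z1; have wn0 := halfplane_addr1_neq0 w0.
have sz : s ((1 + z) / (1 - z)) = z.
  rewrite /s; field; rewrite n0 /=.
  by rewrite (_ : _ + _ = 2) ?pnatr_eq0 //; ring.
have := hb _ w0; rewrite hE // sz.
move: (_ / _) w0 => w w0 E.
(* Real parts give [u * Re w = c * Re w]; once [u = c], imaginary parts give [v = b]. *)
have uc : Re (f z) = c.
  apply: (mulIf (lt0r_neq0 w0)); move: E => /(congr1 (fun z => Re z)).
  by rewrite !(complex_ReD, complex_ReM) /=; lra.
apply: complex_ext => //=; move: E => /(congr1 (fun z => Im z)).
by rewrite uc !(complex_ImD, complex_ImM) /=; lra.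
Qed.

End HalfPlane.

(** * Inner products: Cauchy-Schwarz and polarization *)

Section InnerProduct.
Variables (R : realType) (H : lmodType R[i]) (ip : H -> H -> R[i]).
Hypothesis ipP : inner_product_axioms ip.
Implicit Types x y z : H.
Local Notation normc := (@Normc.normc R).

Lemma ip_linear_l (a : R[i]) x y z : ip (a *: x + y) z = a * ip x z + ip y z.
Proof. by case: ipP. Qed.

Lemma ip_conj x y : ip y x = (ip x y)^*.
Proof. by case: ipP. Qed.

Lemma ip_self_ge0 x : 0 <= ip x x. Proof. by case: ipP. Qed.

Lemma ip_addl x y z : ip (x + y) z = ip x z + ip y z.
Proof. by have := ip_linear_l 1 x y z; rewrite scale1r mul1r. Qed.

Lemma ip_0l z : ip 0 z = 0.
Proof. by apply: (addIr (ip 0 z)); rewrite -ip_addl !add0r. Qed.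

Lemma ip_scalel a x z : ip (a *: x) z = a * ip x z.
Proof. by have := ip_linear_l a x 0 z; rewrite ip_0l !addr0. Qed.

Lemma ip_oppl x z : ip (- x) z = - ip x z.
Proof. by rewrite -scaleN1r ip_scalel mulN1r. Qed.

Lemma ip_addr x y z : ip z (x + y) = ip z x + ip z y.
Proof. by rewrite ip_conj ip_addl rmorphD /= -!ip_conj. Qed.

Lemma ip_scaler a x z : ip z (a *: x) = a^* * ip z x.
Proof. by rewrite ip_conj ip_scalel rmorphM /= -ip_conj. Qed.

Lemma ip_oppr x z : ip z (- x) = - ip z x.
Proof. by rewrite ip_conj ip_oppl rmorphN /= -ip_conj. Qed.

(** For [x] nonzero, the square of the inequality is the nonnegativity of [<r, r>] for the component
    [r] of [y] orthogonal to [x]. *)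
Lemma cauchy_schwarz y x : `|ip y x| <= hnorm ip y * hnorm ip x.
Proof.
have [x0|x0] := eqVneq (ip x x) 0.
  have -> : x = 0 by case: ipP => _ _ _; apply.
  by rewrite ip_conj !ip_0l conjC0 normr0 /hnorm ip_0l sqrtC0 mulr0.
have xp : 0 < ip x x by rewrite lt_def x0 ip_self_ge0.
have sq : `|ip y x| ^+ 2 <= ip y y * ip x x.
  have := ip_self_ge0 (y - (ip y x / ip x x) *: x).
  rewrite !(ip_addl, ip_addr, ip_oppl, ip_oppr, ip_scalel, ip_scaler).
  rewrite rmorphM fmorphV /= -!ip_conj => E.
  rewrite normCK -ip_conj -subr_ge0.
  rewrite -(pmulr_lge0 _ (_ : 0 < (ip x x)^-1)) ?invr_gt0 //.
  by move: E; congr (0 <= _); field.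
rewrite -(ler_pXn2r (_ : 0 < 2)%N) ?nnegrE ?mulr_ge0 ?sqrtC_ge0 ?ip_self_ge0 //.
by rewrite exprMn !sqrtCK.
Qed.

(** With [y = T x], the vectors [x + y] and ['i *: y + x] give [<T y, x> = - <y, y>] and
    [<T y, x> = <y, y>], so [<y, y> = 0]. *)
Lemma quadratic_form_eq0 (T : H -> H) :
  (forall (a : R[i]) x y, T (a *: x + y) = a *: T x + T y) ->
  (forall x, ip (T x) x = 0) -> forall x, T x = 0.
Proof.
move=> Tl T0 x; case: ipP => _ _ _; apply; set y := T x.
have e1 := T0 (1 *: x + y); have e2 := T0 ('i *: y + x).
rewrite Tl !(ip_addl, ip_addr, ip_scalel, ip_scaler) !T0 in e1.
rewrite Tl !(ip_addl, ip_addr, ip_scalel, ip_scaler) !T0 in e2.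
rewrite -/y conjCi conjC1 in e1 e2.
have i0 : 'i != 0 :> R[i] by exact: neq0Ci.
have E1 : ip y y + ip (T y) x = 0 by rewrite -[RHS]e1; ring.
have /eqP E2 : 'i * (ip (T y) x - ip y y) = 0 by rewrite -[RHS]e2; ring.
move: E2; rewrite mulf_eq0 (negPf i0) subr_eq0 => /eqP E2.
by move/eqP: E1; rewrite E2 -mulr2n mulrn_eq0 => /eqP.
Qed.

End InnerProduct.

(** For each vector [x], of any length, the scalar case applies to [u |-> <F u x, x>] with upper
    bound [<x, x>]; polarization applied to [F z - F w] concludes. *)
Theorem theorem2 (R : realType) (H : lmodType R[i]) (ip : H -> H -> R[i])
    (F Fstar : R[i] -> H -> H) :
  separable_complex_hilbert ip ->
  (forall z, open_unit_disk z -> bounded_op ip (F z)) ->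
  (forall z, open_unit_disk z -> is_adjoint ip (F z) (Fstar z)) ->
  (forall z, open_unit_disk z ->
     op_le ip (fun _ => 0) (opRe (F z) (Fstar z)) /\
     op_le ip (opRe (F z) (Fstar z)) id) ->
  holomorphic_on_disk ip (fun z x => F z x + z *: Fstar z x) ->
  forall z w, open_unit_disk z -> open_unit_disk w -> F z = F w.
Proof.
move=> [ipP _ _] Fb Fadj Fre Fhol z w z1 w1.
have diskE (u : R[i]) : open_unit_disk u <-> Normc.normc u < 1.
  by rewrite /open_unit_disk normc_lt.
pose f x u := ip (F u x) x.
have starE x u : open_unit_disk u -> ip (Fstar u x) x = conjc (f x u).
  by move=> u1; rewrite (ip_conj ipP) -(Fadj u u1).
have fE x : f x z = f x w.
  apply: (@scalar_rigidity R (f x) (Re (ip x x))) => [u /diskE u1|u /diskE u1||];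
    try exact/diskE.
    have [/(_ x) l1 /(_ x) l2] := Fre u u1.
    move: l1 l2; rewrite /opRe subr0 /= !(ip_addl ipP, ip_oppl ipP, ip_scalel ipP).
    rewrite starE // -/(f x u) mulrC -ReJ_add ler0c => ->.
    by rewrite lecE complex_ReD complex_ReN subr_ge0 => /andP[].
  have [L [_ HL]] := Fhol u u1.
  exists (ip (L x) x); apply/has_derivative_complexP => e e0.
  have X0 : 0 <= ip x x := ip_self_ge0 ipP x.
  have X1 : 0 < 1 + ip x x by rewrite ltr_pwDl.
  (* By Cauchy-Schwarz the operator error is multiplied by [<x, x>]; the added [1] allows
     [x = 0]. *)
  have [|dl [dl0 Hd]] := HL (e%:C%C / (1 + ip x x)).
    by rewrite divr_gt0 // ltcR.
  have [r r0 rE] := gt0_real_complex dl0.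
  (* The bound [1 - normc u] keeps [u + h] in the disk. *)
  exists (Num.min r (1 - Normc.normc u)); first by rewrite lt_min r0 subr_gt0; apply/diskE.
  move=> h; rewrite lt_min ltrBrDr addrC => /andP[hr hu].
  have [->|h0] := eqVneq h 0.
    by rewrite addr0 mulr0 subr0 subrr Normc.normc0 mulr0.
  have uh1 : open_unit_disk (u + h).
    by apply/diskE; apply: le_lt_trans (normc_triangle _ _) hu.
  have := Hd (u + h) uh1; rewrite (addrC u) addrK normr_gt0 h0 rE normc_lt // hr.
  move=> /(_ isT x); set v := _ - L x => Hv.
  have vE : f x (h + u) + (h + u) * conjc (f x (h + u)) - (f x u + u * conjc (f x u))
      - ip (L x) x * h = ip v x * h.
    rewrite /v !(ip_addl ipP, ip_oppl ipP, ip_scalel ipP).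
    have hu1 : open_unit_disk (h + u) by rewrite addrC.
    by rewrite !starE // /f; field.
  rewrite vE Normc.normcM ler_wpM2r ?normc_ge0 // -lecR -normr_normc.
  apply: le_trans (cauchy_schwarz ipP v x) _.
  have hn0 : 0 <= hnorm ip x by rewrite sqrtC_ge0.
  apply: le_trans (ler_wpM2r hn0 Hv) _.
  have XX : hnorm ip x * hnorm ip x = ip x x by rewrite -expr2 sqrtCK.
  rewrite -(mulrA (_ / _)) XX mulrAC ler_pdivrMr // ler_wpM2l ?ler0c ?(ltW e0) //.
  by rewrite lerDr ler01.
apply/funext => x; apply/eqP; rewrite -subr_eq0; apply/eqP.
apply: (quadratic_form_eq0 ipP (T := fun x => F z x - F w x)) => [a y y'|y].
  by rewrite (proj1 (Fb z z1)) (proj1 (Fb w w1)) scalerBr opprD addrACA.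
by rewrite (ip_addl ipP) (ip_oppl ipP) -/(f y z) fE subrr.
Qed.
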